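(* Let $n\ge 2$ and let $\Gamma$ be a finite index subgroup of $SL_n(\mathbb{Z})$. Then for any $\epsilon>0$ and any $k\in\mathbb{N}$ there exists a finite index subgroup $\Gamma'\le\Gamma$ such that for every finite index subgroup $\Delta\le\Gamma'$ and every generating set $S$ of $\Delta$ with $|S|=k$ one has $\kappa(\Delta,S)<\epsilon$.
   Context: $\mathbb{N}=\{1,2,\dots\}$. For a finitely generated discrete group $\Delta$, a subset $S\subset\Delta$, and a unitary representation $(\pi,\mathcal{H})$ of $\Delta$ on a non-zero Hilbert space without non-zero invariant vectors, let $\kappa(\Delta,S,\mathcal{H})$ be the largest $\epsilon\ge 0$ such that $\max_{s\in S}\|\pi(s)v-v\|\ge\epsilon\|v\|$ for all $v\in\mathcal{H}$. The Kazhdan constant $\kappa(\Delta,S)$ is the infimum of $\kappa(\Delta,S,\mathcal{H})$ over all unitary representations $\mathcal{H}$ of $\Delta$ without non-zero invariant vectors. *)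

(* Defs.v *)
From HB Require Import structures.
From mathcomp Require Import all_boot all_order all_algebra.
From mathcomp Require Import finmap complex sesquilinear.
From mathcomp Require Import all_classical all_reals all_analysis.

Set Implicit Arguments.
Unset Strict Implicit.
Unset Printing Implicit Defensive.

Import Order.TTheory GRing.Theory Num.Theory Num.Def.
Import numFieldNormedType.Exports.

Local Open Scope classical_set_scope.
Local Open Scope ring_scope.
Local Open Scope complex_scope.

Section SLZ.
Variable n : nat.

Record SLZ := MkSLZ {SLZ_mx :> 'M[int]_n; _ : \det SLZ_mx == 1}.

HB.instance Definition _ := [isSub for SLZ_mx].
HB.instance Definition _ := [Choice of SLZ by <:].

Implicit Types A B C : SLZ.

Definition SLZ_one : SLZ := MkSLZ (introT eqP (det1 int n)).

Fact SLZ_mul_subproof A B : \det (val A *m val B) == 1.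
Proof. by rewrite det_mulmx (eqP (valP A)) (eqP (valP B)) mulr1. Qed.

Definition SLZ_mul A B : SLZ := MkSLZ (SLZ_mul_subproof A B).

Fact SLZ_unitmx A : val A \in unitmx.
Proof. by rewrite unitmxE (eqP (valP A)) unitr1. Qed.

Fact SLZ_inv_subproof A : \det (invmx (val A)) == 1.
Proof. by rewrite det_inv (eqP (valP A)) invr1. Qed.

Definition SLZ_inv A : SLZ := MkSLZ (SLZ_inv_subproof A).

Fact SLZ_mulA : associative SLZ_mul.
Proof. by move=> A B C; apply/val_inj/mulmxA. Qed.

Fact SLZ_mul1 : left_id SLZ_one SLZ_mul.
Proof. by move=> A; apply/val_inj/mul1mx. Qed.

Fact SLZ_mulr1 : right_id SLZ_one SLZ_mul.
Proof. by move=> A; apply/val_inj/mulmx1. Qed.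

Fact SLZ_mulV : left_inverse SLZ_one SLZ_inv SLZ_mul.
Proof. by move=> A; apply/val_inj/mulVmx/SLZ_unitmx. Qed.

Fact SLZ_mulrV : right_inverse SLZ_one SLZ_inv SLZ_mul.
Proof. by move=> A; apply/val_inj/mulmxV/SLZ_unitmx. Qed.

HB.instance Definition _ :=
  isGroup.Build SLZ SLZ_mulA SLZ_mul1 SLZ_mulr1 SLZ_mulV SLZ_mulrV.

End SLZ.

(* Subgroups of G are values of [groupClosed G]: boolean predicates containing
   1 and closed under products and inverses.  Under the classical axioms of
   MathComp-Analysis every subgroup is of this form. *)
Section Subgroups.
Variable G : groupType.

Section SubgroupType.
Variable D : groupClosed G.

Record subgroup_type := MkSubgroup {subgroup_val :> G; _ : subgroup_val \in D}.

HB.instance Definition _ := [isSub for subgroup_val].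
HB.instance Definition _ := [Choice of subgroup_type by <:].

Fact subgroup_closed : group_closed [in D].
Proof. by split=> [|x y xD yD]; [exact: gpred1 | exact: gpredF]. Qed.

HB.instance Definition _ :=
  SubChoice_isSubGroup.Build G [in D] subgroup_type subgroup_closed.

End SubgroupType.

Definition left_cosets (D E : {pred G}) : set (set G) :=
  [set [set (x * d)%g | d in [set` D]] | x in [set` E]].

Definition finite_index_in (D E : {pred G}) : Prop :=
  {subset D <= E} /\ finite_set (left_cosets D E).

Definition generates (S : {fset G}) : Prop :=
  forall K : groupClosed G, {subset S <= K} -> forall x, x \in K.

End Subgroups.

(* The norm of a normed module over R[i] takes its values in R[i]; [hdot] is
   linear on the left and conjugate-linear on the right. *)
HB.mixin Record CompleteNormedModule_isHilbert (R : realType) H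
    & CompleteNormedModule R[i] H := {
  hdot : {dot H for (conjC : R[i] -> R[i])};
  hdot_norm : forall v : H, hdot v v = `|v| ^+ 2
}.

#[short(type="hilbertType")]
HB.structure Definition Hilbert (R : realType) :=
  {H of CompleteNormedModule_isHilbert R H & CompleteNormedModule R[i] H}.

Definition hnorm (R : realType) (H : hilbertType R) (v : H) : R :=
  complex.Re `|v|.

Section HilbertNorm.
Variables (R : realType) (H : hilbertType R).
Implicit Type v : H.

Lemma hnormE v : `|v| = (hnorm v)%:C.
Proof. by rewrite /hnorm RRe_real // ger0_real. Qed.

Lemma hnorm_ge0 v : 0 <= hnorm v.
Proof. by rewrite -lecR -hnormE normr_ge0. Qed.

Lemma hnorm_eq0 v : (hnorm v == 0) = (v == 0).
Proof. by rewrite -(normr_eq0 v) hnormE -(inj_eq (@complexI R)). Qed.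

Lemma hnorm_gt0 v : (0 < hnorm v) = (v != 0).
Proof. by rewrite lt_def hnorm_eq0 hnorm_ge0 andbT. Qed.

End HilbertNorm.

(* Surjectivity of each [urep g] follows from [urep1] and [urepM]. *)
Record unitary_rep (G : groupType) (R : realType) (H : hilbertType R) :=
  UnitaryRep {
    urep :> G -> {linear H -> H};
    urep1 : forall v, urep 1%g v = v;
    urepM : forall g h v, urep (g * h)%g v = urep g (urep h v);
    urep_dot : forall g u v, hdot (urep g u) (urep g v) = hdot u v
  }.

Section KazhdanConstant.
Variables (G : groupType) (S : {fset G}) (R : realType).

Definition no_invariant_vectors (H : hilbertType R) (pi : unitary_rep G H) :=
  forall v, (forall g, pi g v = v) -> v = 0.

Definition kazhdan_bounds (H : hilbertType R) (pi : unitary_rep G H) : set R :=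
  [set e | 0 <= e /\ forall v : H,
     e * hnorm v <= \big[Num.max/0]_(s <- S) hnorm (pi s v - v)].

Definition rep_kazhdan_constant (H : hilbertType R) (pi : unitary_rep G H) : R :=
  sup (kazhdan_bounds pi).

(* On a non-zero space the supremum is attained, so that
   [rep_kazhdan_constant] is the largest element of [kazhdan_bounds]. *)
Lemma rep_kazhdan_constant_max (H : hilbertType R) (pi : unitary_rep G H) :
  (exists v : H, v != 0) ->
  kazhdan_bounds pi (rep_kazhdan_constant pi) /\
  forall e, kazhdan_bounds pi e -> e <= rep_kazhdan_constant pi.
Proof.
move=> [w w0].
have maxge0 v : 0 <= \big[Num.max/0]_(s <- S) hnorm (pi s v - v).
  by elim/big_rec: _ => // i x _ x0; rewrite le_max x0 orbT.
have K0 : kazhdan_bounds pi 0 by split=> // v; rewrite mul0r.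
have ub : has_sup (kazhdan_bounds pi).
  split; first by exists 0.
  exists ((\big[Num.max/0]_(s <- S) hnorm (pi s w - w)) / hnorm w) => e [_].
  by move=> /(_ w); rewrite ler_pdivlMr ?hnorm_gt0.
have ubd e : kazhdan_bounds pi e -> e <= rep_kazhdan_constant pi.
  by move=> he; apply: sup_upper_bound.
split=> //; split; first exact: ubd.
move=> v; have [->|v0] := eqVneq v 0.
  by rewrite /(hnorm 0) normr0 /= mulr0.
rewrite -ler_pdivlMr ?hnorm_gt0 //; apply: ge_sup; first by exists 0.
by move=> e [_ /(_ v)]; rewrite ler_pdivlMr ?hnorm_gt0.
Qed.

(* Extended-real valued: the infimum is +oo if every representation on a
   non-zero space has non-zero invariant vectors, i.e. for trivial G. *)
Definition kazhdan_constant : \bar R :=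
  ereal_inf [set x | exists (H : hilbertType R) (pi : unitary_rep G H),
    [/\ exists v : H, v != 0, no_invariant_vectors pi
      & x = (rep_kazhdan_constant pi)%:E]].

End KazhdanConstant.

(* Main.v *)
Require Import Defs.
From HB Require Import structures.
From mathcomp Require Import all_boot all_order all_algebra finmap.
From mathcomp Require Import complex sesquilinear.
From mathcomp Require Import all_classical all_reals all_analysis.
From mathcomp Require Import ring lra.

Set Implicit Arguments.
Unset Strict Implicit.
Unset Printing Implicit Defensive.

Import Order.TTheory GRing.Theory Num.Theory Num.Def.
Import numFieldNormedType.Exports.

Local Open Scope classical_set_scope.
Local Open Scope ring_scope.
Local Open Scope complex_scope.

(** The theorem comes down to finding characters: if [chi] is a nontrivial
    unitary character of a group with |chi s - 1| < eps for every [s] in [S],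
    then the one-dimensional representation given by [chi] has no nonzero
    invariant vector and shows that the Kazhdan constant is below [eps]
    ([kazhdan_constant_lt_character]).

    Such characters exist as soon as the group maps onto a cyclic group of
    large prime order [p], where large depends only on [eps] and the number
    [k] of elements of [S]. Take a nontrivial character [chi] of order [p]. By
    the pigeonhole argument of Dirichlet, among the first [N] powers of [chi],
    with [N] depending only on [eps] and [k], two are close to each other at
    all points of [S], so that some [chi ^+ m] with [0 < m < N] is close to 1
    on [S] ([simultaneous_approximation]). When [p > N], the character
    [chi ^+ m] is still nontrivial.

    It remains to choose [Gamma'] such that all its finite-index subgroups map
    onto Z/p. Let it be the intersection of [Gamma] with the congruence
    subgroup of level [p]. A finite-index subgroup [Delta] of it is nontrivial,
    because it contains a power of a transvection, which has infinite order
    ([finite_index_expg], [SLZ_infinite_order]). Hence there is a largest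
    [m >= 1] for which [Delta] lies in the congruence subgroup of level p^m,
    and the reduction of (g - 1) / p^m modulo [p] is a nonzero homomorphism
    from [Delta] to the additive group of matrices over F_p; one of its entries
    is onto Z/p ([congruence_quotient]). *)

(** * The complex numbers as a one-dimensional Hilbert space *)

(** A separate name, so that inferring completeness on it does not compete with
    the instance that makes [K^o] complete for a real field [K]. *)
Definition complex_line (R : realType) : Type := R[i].

Section ComplexLine.
Variable R : realType.
Implicit Types (x y z : R[i]) (e : R).

Lemma normc_le_ReIm z :
  `|z| <= (`|complex.Re z| + `|complex.Im z|)%:C.
Proof.
have normi : `|'i%C : R[i]| = 1.
  by apply/eqP; rewrite -sqrp_eq1 // -normrX sqr_i normrN1.
have normC (x : R) : `|x%:C| = `|x|%:C.
  by rewrite normc_def /= expr0n addr0 sqrtr_sqr.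
rewrite {1}[z]complexE (le_trans (ler_normD _ _)) //.
by rewrite normrM normi mul1r !normC rmorphD.
Qed.

Lemma normc_ge_Im z : `|complex.Im z|%:C <= `|z|.
Proof.
case: z => a b; rewrite normc_def lecR /= -sqrtr_sqr ler_sqrt.
  by rewrite lerDr sqr_ge0.
by rewrite addr_ge0 ?sqr_ge0.
Qed.

Lemma complex_gt0P x : 0 < x -> exists2 e, 0 < e & x = e%:C.
Proof.
by case: x => a b; rewrite ltcE /= => /andP[/eqP-> a0]; exists a.
Qed.

HB.instance Definition _ := NormedModule.copy (complex_line R) R[i]^o.

(** The real and imaginary parts are 1-Lipschitz, so they send a Cauchy filter
    to Cauchy filters on the complete line [R]; their limits are the two parts
    of the limit. *)
Lemma complex_complete (F : set_system (complex_line R)) :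
  ProperFilter F -> cauchy F -> cvg F.
Proof.
move=> FF /cauchy_ballP Fc.
have part_cvg (f : complex_line R -> R) :
    (forall x y, `|f x - f y|%:C <= `|x - y|) -> cvg (f @ F).
  move=> f_lip; apply: R_complete; apply/cauchy_ballP => e e0.
  near_simpl.
  have eC0 : 0 < e%:C by rewrite ltcR.
  apply: filterS (Fc _ eC0) => -[x y] /=.
  rewrite -!ball_normE /= => xy; rewrite -ltcR.
  exact: le_lt_trans (f_lip _ _) xy.
have cRe : cvg (@complex.Re R @ F).
  by apply: part_cvg => x y; rewrite -raddfB normc_ge_Re.
have cIm : cvg (@complex.Im R @ F).
  by apply: part_cvg => x y; rewrite -raddfB normc_ge_Im.
apply/cvg_ex; exists (lim (@complex.Re R @ F) +i* lim (@complex.Im R @ F)).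
apply/cvgrPdist_lt => /= x /complex_gt0P[e e0 ->].
have e20 : 0 < e / 2 by rewrite divr_gt0.
move/cvgrPdist_lt: cRe => /(_ _ e20) cRe.
move/cvgrPdist_lt: cIm => /(_ _ e20) cIm.
near=> z.
rewrite (le_lt_trans (normc_le_ReIm _)) // ltcR !raddfB /=.
rewrite [e]splitr ltrD //.
  by near: z.
by near: z.
Unshelve. all: by end_near. Qed.

HB.instance Definition _ :=
  Uniform_isComplete.Build (complex_line R) complex_complete.

Definition cdot (u v : complex_line R) : R[i] := u * conjC v.

Fact cdot_bilinear :
  bilinear_for ( *%R : GRing.Scale.law _ _)
    ((conjC : {rmorphism R[i] -> R[i]}) \; *%R) cdot.
Proof.
by split=> w a u v; rewrite /cdot ?rmorphD ?rmorphM /GRing.scale /=; ring.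
Qed.

HB.instance Definition _ :=
  bilinear_isBilinear.Build R[i] (complex_line R) (complex_line R) R[i] _ _
    cdot cdot_bilinear.

Fact cdot_hermitian (u v : complex_line R) :
  cdot u v = (-1) ^+ false * conjC (cdot v u).
Proof. by rewrite /cdot expr0 mul1r rmorphM /= conjCK mulrC. Qed.

HB.instance Definition _ :=
  isHermitianSesquilinear.Build R[i] (complex_line R) false
    (conjC : R[i] -> R[i]) cdot cdot_hermitian.

Fact cdot_gt0 (u : complex_line R) : u != 0 -> 0 < cdot u u.
Proof. by move=> u0; rewrite /cdot -normCK exprn_gt0 ?normr_gt0. Qed.

HB.instance Definition _ :=
  isDotProduct.Build R[i] (complex_line R) cdot cdot_gt0.

Fact cdot_norm (v : complex_line R) : cdot v v = `|v| ^+ 2.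
Proof. by rewrite /cdot -normCK. Qed.

HB.instance Definition _ :=
  CompleteNormedModule_isHilbert.Build R (complex_line R) cdot_norm.

Definition line_scale (z : R[i]) (v : complex_line R) : complex_line R :=
  z *: v.

Fact line_scale_linear z : linear (line_scale z).
Proof. by move=> a u v; rewrite /line_scale /GRing.scale /=; ring. Qed.

HB.instance Definition _ z :=
  GRing.isLinear.Build R[i] (complex_line R) (complex_line R) _
    (line_scale z) (line_scale_linear z).

End ComplexLine.

(** * Characters bound the Kazhdan constant *)

Section CharacterRep.
Variables (G : groupType) (R : realType) (chi : G -> R[i]).
Hypothesis chi1 : chi 1%g = 1.
Hypothesis chiM : forall g h, chi (g * h)%g = chi g * chi h.
Hypothesis norm_chi : forall g, `|chi g| = 1.

Let line_scale1 (v : complex_line R) : line_scale (chi 1%g) v = v.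
Proof. by rewrite /line_scale chi1 scale1r. Qed.

Let line_scaleM g h (v : complex_line R) :
  line_scale (chi (g * h)%g) v = line_scale (chi g) (line_scale (chi h) v).
Proof. by rewrite /line_scale chiM scalerA. Qed.

Let line_scale_dot g (u v : complex_line R) :
  hdot (line_scale (chi g) u) (line_scale (chi g) v) = hdot u v.
Proof.
rewrite -[LHS]/(cdot _ _) -[RHS]/(cdot _ _) /cdot /line_scale /GRing.scale /=.
by rewrite rmorphM /= mulrACA -normCK norm_chi expr1n mul1r.
Qed.

Definition character_rep : unitary_rep G (complex_line R) :=
  UnitaryRep line_scale1 line_scaleM line_scale_dot.

(** The vector 1 is moved by less than [eps] by each element of [S], whereas an
    element [g] with [chi g != 1] fixes only 0. *)
Lemma kazhdan_constant_lt_character (S : {fset G}) (eps : R) :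
  0 < eps -> (exists g, chi g != 1) ->
  (forall s, s \in S -> `|chi s - 1| < eps%:C) ->
  (kazhdan_constant S R < eps%:E)%E.
Proof.
move=> eps0 [g0 chig0] chi_near1.
have one_norm : hnorm (1 : complex_line R) = 1 by rewrite /hnorm normr1.
apply: (@le_lt_trans _ _ (rep_kazhdan_constant S character_rep)%:E).
  apply: ereal_inf_lbound; exists (complex_line R), character_rep; split=> //.
    by exists 1; rewrite oner_eq0.
  move=> v /(_ g0) /= /eqP.
  rewrite /line_scale -subr_eq0 -[X in _ - X]scale1r -scalerBl scaler_eq0.
  by rewrite subr_eq0 (negPf chig0) => /eqP.
rewrite lte_fin.
apply: (@le_lt_trans _ _
  (\big[Num.max/0]_(s <- S) hnorm (character_rep s 1 - 1))).
  apply: ge_sup.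
    exists 0; split=> // v; rewrite mul0r.
    by elim/big_rec: _ => // i x _ x0; rewrite le_max x0 orbT.
  by move=> e [_ /(_ 1)]; rewrite one_norm mulr1.
rewrite big_seq; elim/big_ind: _ => // [x y xe ye|s sS].
  by rewrite gt_max xe ye.
rewrite -ltcR -hnormE /= /line_scale.
have -> : chi s *: (1 : complex_line R) = chi s.
  by rewrite /GRing.scale /= mulr1.
exact: chi_near1.
Qed.

End CharacterRep.

(** * Simultaneous approximation on the unit circle *)

Section Dirichlet.
Variable R : realType.

(** The index of the interval of length 1/M containing [a], in the subdivision
    of [-1, 1]; the last index is reached only by [a = 1]. *)
Definition grid_cell M (a : R) : 'I_(2 * M).+1 :=
  inord (truncn (M%:R * (a + 1))).

Lemma grid_cell_dist M (a b : R) : (0 < M)%N -> `|a| <= 1 -> `|b| <= 1 ->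
  grid_cell M a = grid_cell M b -> `|a - b| < M%:R^-1.
Proof.
move=> M0 a1 b1.
have M0R : 0 < M%:R :> R by rewrite ltr0n.
have scaled_ge0 (c : R) : `|c| <= 1 -> 0 <= M%:R * (c + 1).
  by rewrite ler_norml => /andP[c1 _]; rewrite mulr_ge0 ?ler0n //; lra.
have cell_val (c : R) : `|c| <= 1 ->
    grid_cell M c = truncn (M%:R * (c + 1)) :> nat.
  move=> c1; rewrite inordK // ltnS.
  rewrite -(ler_nat R).
  have /andP[/le_trans-> //] := truncn_itv (scaled_ge0 _ c1).
  by rewrite mulnC natrM ler_pM2l //; move: c1; rewrite ler_norml; lra.
move=> /(congr1 val) /=; rewrite !cell_val // => eq_trunc.
have /andP[a_ge a_lt] := truncn_itv (scaled_ge0 _ a1).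
have /andP[b_ge b_lt] := truncn_itv (scaled_ge0 _ b1).
rewrite -eq_trunc in b_ge b_lt.
rewrite -[_^-1]mul1r ltr_pdivlMr // -[M%:R in X in X < _]gtr0_norm // -normrM.
rewrite -natr1 in a_lt b_lt.
by rewrite ltr_norml; apply/andP; split; lra.
Qed.

(** Cut the square [-1, 1]^2 into cells of side less than eps/2. There are more
    exponents [j < N] than [k]-tuples of cells, so two tuples of powers
    [z i ^+ j0] and [z i ^+ j1] fall in the same cells; as the [z i] have
    modulus 1, their distances are those of [z i ^+ (j1 - j0)] to 1. *)
Lemma simultaneous_approximation (eps : R) k : 0 < eps ->
  exists N, forall z : 'I_k -> R[i], (forall i, `|z i| = 1) ->
  exists2 m, (0 < m < N)%N & forall i, `|z i ^+ m - 1| < eps%:C.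
Proof.
move=> eps0; pose M := (truncn (2 / eps)).+1.
pose cells := {ffun 'I_k -> 'I_(2 * M).+1 * 'I_(2 * M).+1}.
exists #|cells|.+1 => z z1.
pose f (j : 'I_#|cells|.+1) : cells :=
  [ffun i => (grid_cell M (complex.Re (z i ^+ j)),
              grid_cell M (complex.Im (z i ^+ j)))].
have [j0 [j1 j01 fj01]] : exists j0, exists2 j1, j0 != j1 & f j0 = f j1.
  by apply/injectivePn/injectiveP => /leq_card; rewrite card_ord ltnn.
wlog lt_j : j0 j1 j01 fj01 / (j0 < j1)%N.
  move=> th; move: j01; rewrite -val_eqE neq_ltn /= => /orP[lt_j|lt_j].
    by apply: (th j0 j1); rewrite // -val_eqE neq_ltn lt_j.
  by apply: (th j1 j0); rewrite // -val_eqE neq_ltn lt_j.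
exists (j1 - j0)%N.
  by rewrite subn_gt0 lt_j /= (leq_ltn_trans (leq_subr _ _)).
move=> i; move: (congr1 (fun g : cells => g i) fj01); rewrite !ffunE.
set x := z i ^+ j0; set y := z i ^+ j1 => -[eqRe eqIm].
have x1 : `|x| = 1 by rewrite normrX z1 expr1n.
have y1 : `|y| = 1 by rewrite normrX z1 expr1n.
have -> : `|z i ^+ (j1 - j0) - 1| = `|x - y|.
  rewrite -[LHS]mul1r -{1}x1 -normrM mulrBr mulr1 distrC /x /y -exprD.
  rewrite subnKC //.
  exact: ltnW.
have Re1 (w : R[i]) : `|w| = 1 -> `|complex.Re w| <= 1.
  by move=> w1; rewrite -lecR (le_trans (normc_ge_Re _)) ?w1.
have Im1 (w : R[i]) : `|w| = 1 -> `|complex.Im w| <= 1.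
  by move=> w1; rewrite -lecR (le_trans (normc_ge_Im _)) ?w1.
rewrite (le_lt_trans (normc_le_ReIm _)) // ltcR !raddfB /=.
have M_inv : M%:R^-1 < eps / 2.
  rewrite -[eps / 2]invrK ltf_pV2 ?posrE ?ltr0n ?invr_gt0 ?divr_gt0 //.
  have e2_ge0 : 0 <= 2 / eps by rewrite divr_ge0 // ltW.
  by rewrite invf_div; have /andP[] := truncn_itv e2_ge0.
rewrite [eps]splitr ltrD // (lt_trans _ M_inv) //.
  by apply: grid_cell_dist; rewrite ?Re1.
by apply: grid_cell_dist; rewrite ?Im1.
Qed.

End Dirichlet.

(** A root of 1 + X + ... + X^(p-1), which takes the nonzero value [p] at 1. *)
Lemma nontrivial_root_of_unity (R : realType) p : prime p ->
  exists2 z : R[i], z ^+ p = 1 & z != 1.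
Proof.
move=> p_pr.
have sz : size (\sum_(i < p) 'X^i : {poly R[i]}) = p.
  have -> : \sum_(i < p) 'X^i = \poly_(i < p) (1 : R[i]).
    by rewrite poly_def; apply: eq_bigr => i _; rewrite scale1r.
  by rewrite size_poly_eq // oner_eq0.
have [|z /rootP] := closed_rootP (\sum_(i < p) 'X^i : {poly R[i]}) _.
  by rewrite sz neq_ltn (prime_gt1 p_pr) orbT.
rewrite horner_sum => z_root; exists z.
  apply/eqP; rewrite -subr_eq0 subrX1.
  rewrite (eq_bigr (fun i : 'I_p => ('X^i).[z])) ?z_root ?mulr0 // => i _.
  by rewrite hornerXn.
apply: contra_eqN z_root => /eqP->.
rewrite (eq_bigr (fun=> 1)) => [|i _]; last by rewrite hornerXn expr1n.
by rewrite sumr_const card_ord pnatr_eq0 -lt0n prime_gt0.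
Qed.

Lemma exprz_root_of_unity (F : fieldType) (z : F) (p : nat) (a : int) :
  prime p -> z ^+ p = 1 -> z != 1 -> ~~ (p %| a)%Z -> z ^ a != 1.
Proof.
move=> p_pr zp z1 p_a; apply: contra z1 => /eqP za.
have z0 : z != 0.
  apply: contra_eqN zp => /eqP->.
  by rewrite expr0n gtn_eqF ?prime_gt0 // eq_sym oner_eq0.
have [u [v uv]] := Bezoutz a p.
have cop : gcdz a p = 1.
  apply/eqP; rewrite -[_ == _]/(coprimez a p) coprimez_sym coprimezE /=.
  by rewrite prime_coprime.
rewrite -[z]expr1z -cop -uv expfzDr // [u * a]mulrC [v * _]mulrC.
by rewrite -!exprz_exp za -exprnP zp !exp1rz mulr1.
Qed.

(** * Subgroups of finite index *)

Section FiniteIndex.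
Variable G : groupType.
Implicit Types (D E : groupClosed G) (x y : G).

(** The cosets of [D] are the nonempty fibers of [f] on [E]. *)
Lemma finite_index_fibers D E (T : finType) (f : G -> T) :
  {subset D <= E} ->
  {in E &, forall x y, (x^-1 * y)%g \in D <-> f x = f y} ->
  finite_index_in D E.
Proof.
move=> sDE fD; split=> //.
apply: (@sub_finite_set _ _
  (range (fun t : T => [set y | y \in E /\ f y = t]))).
  move=> _ [x /= xE <-]; exists (f x) => //.
  apply/seteqP; split=> [y /= [yE fyx]|_ /= [d dD <-]].
    by exists (x^-1 * y)%g; [exact/fD | rewrite mulVKg].
  have xdE : (x * d)%g \in E by rewrite gpredM // sDE.
  by split=> //; apply/esym/fD; rewrite // mulKg.
exact: finite_image.
Qed.

(** By finiteness of the index, [x ^+ i * D] and [x ^+ j * D] coincide for some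
    [i < j], and then [x ^+ (j - i)] lies in [D]. *)
Lemma finite_index_expg (D : groupClosed G) (E : {pred G}) x :
  finite_index_in D E -> (forall i, (x ^+ i)%g \in E) ->
  exists2 m, (0 < m)%N & (x ^+ m)%g \in D.
Proof.
move=> [_ finDE] xnE.
pose h i : set G := [set (x ^+ i * d)%g | d in [set` D]].
apply: contrapT => noD; apply: infinite_nat.
have -> : [set: nat] = h @^-1` left_cosets D E.
  by apply/seteqP; split=> // i _; exists (x ^+ i)%g => //=; exact: xnE.
apply: finite_preimage finDE => i j _ _ hij.
wlog lt_ij : i j hij / (i < j)%N.
  by move=> th; case: (ltngtP i j) => // [lt|gt]; [exact: th | exact/esym/th].
case: noD; exists (j - i)%N; first by rewrite subn_gt0.
have : h j (x ^+ j)%g by exists 1%g; rewrite /= ?gpred1 ?mulg1.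
rewrite -hij => -[d /= dD].
by rewrite -{1}(subnKC (ltnW lt_ij)) expgnDr => /mulgI <-.
Qed.

Definition group_closed_subgroup (S : {pred G}) (S_grp : group_closed S) :
    groupClosed G :=
  GroupClosed.Pack (GroupClosed.Class
    (isInvClosed.Build G S (group_closedV S_grp))
    (isMul1Closed.Build G S S_grp.1)
    (isMulClosed.Build G S (group_closedM S_grp))).

Fact subgroupI_subproof D E :
  group_closed [pred x : G | (x \in D) && (x \in E)].
Proof.
split=> [|x y /andP[xD xE] /andP[yD yE]]; rewrite inE ?gpred1 //.
by rewrite !gpredF.
Qed.

Definition subgroupI D E := group_closed_subgroup (subgroupI_subproof D E).

Lemma in_subgroupI D E x : (x \in subgroupI D E) = (x \in D) && (x \in E).
Proof. by []. Qed.

End FiniteIndex.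

(** * Congruence subgroups *)

Section Congruence.
Variable n : nat.

Definition congruent1 (q : nat) : {pred SLZ n} :=
  [pred A : SLZ n | [forall i, forall j, (q %| (val A - 1%:M) i j)%Z]].

Lemma congruent1P q (A : SLZ n) :
  reflect (exists X : 'M[int]_n, val A = 1%:M + q%:Z *: X)
          (A \in congruent1 q).
Proof.
apply: (iffP idP) => [|[X AX]].
  move=> /forallP qA; exists (map_mx (fun a => a %/ q)%Z (val A - 1%:M)).
  apply/matrixP => i j; have /forallP/(_ j)/divzK := qA i.
  by rewrite !mxE mulrC => ->; rewrite addrC subrK.
apply/forallP => i; apply/forallP => j.
by rewrite AX addrC addKr mxE dvdz_mulr.
Qed.

Fact congruent1_group q : group_closed (congruent1 q).
Proof.
split; first by apply/congruent1P; exists 0; rewrite scaler0 addr0.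
move=> A B /congruent1P[X AX] /congruent1P[Y BY].
apply/congruent1P; exists ((X - Y) *m val (B^-1)%g).
have BV : val B *m val (B^-1)%g = 1%:M by rewrite mulmxV ?SLZ_unitmx.
rewrite -[LHS]/(val A *m val (B^-1)%g) scalemxAl.
have -> : q%:Z *: (X - Y) = val A - val B.
  by rewrite AX BY opprD addrACA subrr add0r scalerBr.
by rewrite mulmxBl BV addrC subrK.
Qed.

Definition congruence_subgroup (q : nat) : groupClosed (SLZ n) :=
  group_closed_subgroup (congruent1_group q).

Lemma congruence_subgroupP q (A : SLZ n) :
  reflect (exists X : 'M[int]_n, val A = 1%:M + q%:Z *: X)
          (A \in congruence_subgroup q).
Proof. exact: congruent1P. Qed.

End Congruence.

(** Reduction modulo [p] separates the cosets and has finitely many values. *)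
Lemma finite_index_congruenceI n p (E : groupClosed (SLZ n)) : prime p ->
  finite_index_in (subgroupI E (congruence_subgroup n p)) E.
Proof.
move=> p_pr.
pose red (A : SLZ n) : 'M['F_p]_n := map_mx intr (SLZ_mx A).
have redM (A B : SLZ n) : red (A * B)%g = red A *m red B by exact: map_mxM.
have red1 : red 1%g = 1%:M by exact: map_mx1.
have redE (A : SLZ n) i j :
    (p %| (val A - 1%:M) i j)%Z = (red A i j == red 1%g i j).
  rewrite (dvdz_pcharf (pchar_Fp p_pr)) -[RHS]subr_eq0.
  by rewrite mxE [(- _ : 'M[int]_n) i j]mxE intrB [red A i j]mxE [red _ i j]mxE.
have redP (A : SLZ n) : A \in congruence_subgroup n p <-> red A = 1%:M.
  rewrite -red1; split=> [/forallP pA|eqA].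
    apply/matrixP => i j; have /forallP/(_ j) := pA i.
    by rewrite redE => /eqP.
  by apply/forallP => i; apply/forallP => j; rewrite redE eqA.
apply: (@finite_index_fibers _ _ _ _ red) => [A /andP[]|A B AE BE] //.
rewrite inE gpredM ?gpredV //=; split=> [/redP|] redAB.
  by rewrite -[B in RHS](mulVKg A) redM redAB mulmx1.
by apply/redP; rewrite redM -redAB -redM mulVg.
Qed.

(** For a matrix unit [N] off the diagonal, [N *m N = 0], so the powers of
    [1 + N] are the matrices [1 + m N]. *)
Lemma SLZ_infinite_order n : (2 <= n)%N ->
  exists u : SLZ n, forall m, (0 < m)%N -> (u ^+ m)%g != 1%g.
Proof.
case: n => [|[|n]] // _.
(* The entry sits below the diagonal, so that [1 + N] is lower triangular. *)
pose N : 'M[int]_n.+2 := delta_mx ord_max ord0.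
have detu : \det (1%:M + N) == 1.
  rewrite det_trig.
    rewrite big1 // => i _; rewrite !mxE eqxx.
    by case: i => [[|i] ?]; rewrite ?andbF ?addr0.
  apply/is_trig_mxP => i j; rewrite !mxE; case: i j => [i ?] [[|j] ?] //=.
  by rewrite -val_eqE /= => /ltn_eqF ->; rewrite andbF addr0.
pose u := MkSLZ detu; exists u => m m0.
have NN : N *m N = 0 by rewrite mul_delta_mx_0.
have um : val (u ^+ m)%g = 1%:M + N *+ m.
  elim: m {m0} => [|m IH]; first by rewrite mulr0n addr0.
  rewrite expgS -[LHS]/((1%:M + N) *m val (u ^+ m)%g) IH.
  rewrite mulmxDl mul1mx mulmxDr mulmx1 -scaler_nat -scalemxAr NN scaler0.
  by rewrite addr0 scaler_nat -addrA -mulrSr.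
apply/eqP => /(congr1 (fun A : SLZ n.+2 => val A ord_max ord0)).
rewrite um !mxE /= add0r mulmxnE mxE !eqxx => /eqP.
by rewrite pnatr_eq0 gtn_eqF.
Qed.

(** A nontrivial matrix has a nonzero entry [a] in [g - 1], and [p ^ m] divides
    [a] only for [m <= |a|]; so no nontrivial group lies in every level of the
    filtration by the [congruence_subgroup n (p ^ m)]. *)
Lemma congruence_depth n p (D : groupClosed (SLZ n)) : prime p ->
  {subset D <= congruence_subgroup n p} -> (exists2 g, g \in D & g != 1%g) ->
  exists m, [/\ (0 < m)%N, {subset D <= congruence_subgroup n (p ^ m)}
    & exists2 h, h \in D & h \notin congruence_subgroup n (p ^ m.+1)].
Proof.
move=> p_pr Dp [g gD g1].
pose deep m := `[< {subset D <= congruence_subgroup n (p ^ m)} >].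
have deep1 : deep 1 by apply/asboolP.
have [i [j gij]] : exists i j, (SLZ_mx g - 1%:M) i j != 0.
  apply: contrapT => none; case/eqP: g1; apply/val_inj/matrixP => i j.
  apply/eqP; rewrite -subr_eq0; apply: contrapT => /negP nz.
  by apply: none; exists i, j; rewrite !mxE in nz *.
have deep_le m : deep m -> (m <= `|((SLZ_mx g - 1%:M) i j)%R|)%N.
  move=> /asboolP/(_ g gD) /forallP/(_ i)/forallP/(_ j).
  rewrite dvdzE => /dvdn_leq; rewrite absz_gt0 gij => /(_ isT).
  by apply: leq_trans; exact/ltnW/ltn_expl/prime_gt1.
have [m /asboolP deep_m max_m] :=
  @ex_maxnP deep _ (ex_intro _ 1%N deep1) deep_le.
exists m; split=> //; first exact: max_m.
apply: contrapT => none; have : deep m.+1.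
  apply/asboolP => h hD; apply: contrapT => /negP hm; apply: none.
  by exists h.
by move/max_m; rewrite ltnn.
Qed.

(** Let [p ^ m] be the deepest level containing [D]. Since
    (1 + p^m X)(1 + p^m Y) = 1 + p^m (X + Y + p^m XY) and [m > 0], the map
    1 + p^m X |-> X mod p is additive on [D]; maximality of [m] makes some
    entry of it nonzero, and that entry is [phi]. Finite-index subgroups of a
    congruence subgroup of level [p] thus all have a quotient of order [p]. *)
Lemma congruence_quotient n p (D : groupClosed (SLZ n)) : prime p ->
  {subset D <= congruence_subgroup n p} -> (exists2 g, g \in D & g != 1%g) ->
  exists phi : SLZ n -> int,
    {in D &, forall g h, (phi (g * h)%g = phi g + phi h %[mod p])%Z} /\
    exists2 g, g \in D & ~~ (p %| phi g)%Z.
Proof.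
move=> p_pr Dp D1.
have [m [m0 deep_m [h hD]]] := congruence_depth p_pr Dp D1.
rewrite inE negb_forall => /existsP[a].
rewrite negb_forall => /existsP[b hab].
have pm0 : (p ^ m)%N%:Z != 0.
  by rewrite gt_eqF // ltz_nat expn_gt0 prime_gt0.
exists (fun x : SLZ n => ((val x - 1%:M) a b %/ (p ^ m)%N)%Z); split.
  move=> x y xD yD.
  have /congruence_subgroupP[X xX] := deep_m _ xD.
  have /congruence_subgroupP[Y yY] := deep_m _ yD.
  have -> : val (x * y)%g - 1%:M
      = (p ^ m)%N%:Z *: (X + Y + (p ^ m)%N%:Z *: (X *m Y)).
    apply/eqP; rewrite subr_eq -[val (x * y)%g]/(val x *m val y) xX yY.
    rewrite mulmxDl mul1mx mulmxDr mulmx1 -scalemxAl -scalemxAr !scalerDr.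
    by rewrite [X in _ == X]addrC -!addrA [_ *: Y + _]addrCA.
  rewrite xX yY ![1%:M + _]addrC !addrK.
  do 3! rewrite [(_ *: _ : 'M[int]_n) a b]mxE mulKz //.
  rewrite !mxE -[m in X in _ + X * _]prednK // expnS PoszM -mulrA.
  by rewrite [X in (X %% _)%Z]addrC [p%:Z * _]mulrC modzMDl.
exists h => //; have /congruence_subgroupP[X hX] := deep_m _ hD.
apply: contra hab => p_dvd.
move: p_dvd; rewrite hX addrC addKr mxE mulKz //.
by rewrite expnSr PoszM dvdz_mul2l.
Qed.

(** * Small Kazhdan constants *)

Theorem proposition1p2 (R : realType) (n : nat) (hn : (2 <= n)%N)
    (Gamma : groupClosed (SLZ n)) (hGamma : finite_index_in Gamma predT)
    (eps : R) (heps : 0 < eps) (k : nat) (hk : (1 <= k)%N) :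
  exists Gamma' : groupClosed (SLZ n),
    finite_index_in Gamma' Gamma /\
    forall Delta : groupClosed (SLZ n), finite_index_in Delta Gamma' ->
    forall S : {fset subgroup_type Delta}, generates S -> #|` S|%fset = k ->
      (kazhdan_constant S R < eps%:E)%E.
Proof.
have [N approx] := simultaneous_approximation k heps.
have [p ltNp p_pr] := prime_above N.
exists (subgroupI Gamma (congruence_subgroup n p)).
have finGamma' := finite_index_congruenceI Gamma p_pr.
split=> // Delta finDelta S _ cardS.
(* [Delta] contains a power of [u], hence is nontrivial. *)
have [u u_inf] := SLZ_infinite_order hn.
have [a a0 ua] :=
  finite_index_expg hGamma (fun i => isT : (u ^+ i)%g \in predT).
have [b b0 ub] := finite_index_expg finGamma' (fun i => gpredXn i ua).
have [c c0 uc] := finite_index_expg finDelta (fun i => gpredXn i ub).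
have Delta_p : {subset Delta <= congruence_subgroup n p}.
  by move=> g /finDelta.1; rewrite in_subgroupI => /andP[].
have [phi [phiD [g0 g0D phig0]]] : exists phi : SLZ n -> int,
    {in Delta &, forall g h, (phi (g * h)%g = phi g + phi h %[mod p])%Z} /\
    exists2 g, g \in Delta & ~~ (p %| phi g)%Z.
  apply: congruence_quotient => //; exists (((u ^+ a) ^+ b) ^+ c)%g => //.
  by rewrite -!expgnA u_inf // !muln_gt0 a0 b0.
have [z zp z1] := nontrivial_root_of_unity R p_pr.
have norm_z : `|z| = 1.
  apply/eqP; rewrite -(@pexpr_eq1 _ _ p) ?prime_gt0 //.
  by rewrite -normrX zp normr1.
have z_neq0 : z != 0 by rewrite -normr_eq0 norm_z oner_eq0.
have z_mod (d e : int) : (d = e %[mod p])%Z -> z ^ d = z ^ e.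
  move=> /eqP; rewrite eqz_mod_dvd => /dvdzP[q dq].
  rewrite -[d](subrK e) dq expfzDr // mulrC [q * _]mulrC -exprz_exp.
  by rewrite -exprnP zp exp1rz mulr1.
pose chi (g : subgroup_type Delta) : R[i] := z ^ phi (val g).
have norm_chi g : `|chi g| = 1.
  rewrite /chi; case: (phi _) => d;
  by rewrite /exprz ?normfV normrX norm_z expr1n ?invr1.
have chiM g h : chi (g * h)%g = chi g * chi h.
  by rewrite /chi -expfzDr //; apply/z_mod/phiD; exact: valP.
(* Multiplicativity alone forces [chi 1 = 1], as [chi] does not vanish. *)
have chi1 : chi 1%g = 1.
  have chi1_neq0 : chi 1%g != 0 by rewrite -normr_eq0 norm_chi oner_eq0.
  by apply: (mulfI chi1_neq0); rewrite -chiM mulg1 mulr1.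
have [i|m /andP[m0 ltmN] near1] := approx (fun i => chi (nth 1%g S i)).
  exact: norm_chi.
apply: (@kazhdan_constant_lt_character _ _ (fun g => chi g ^+ m)) => //.
- by rewrite chi1 expr1n.
- by move=> g h; rewrite chiM exprMn.
- by move=> g; rewrite normrX norm_chi expr1n.
(* [p] divides neither [phi g0] nor [m], the latter because [0 < m < N < p]. *)
- exists (Sub g0 g0D); rewrite /chi exprnP exprz_exp.
  apply: (exprz_root_of_unity p_pr zp z1); rewrite dvdzE abszM Euclid_dvdM //.
  rewrite negb_or -dvdzE phig0 /=.
  by rewrite gtnNdvd // (ltn_trans ltmN).
- move=> s sS; have lt_s : (index s S < k)%N by rewrite -cardS index_mem.
  by have := near1 (Ordinal lt_s); rewrite /= nth_index.
Qed.
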